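(* Let $\{f_{i,j}^{n}\}$, $n=0,\dots,N_t$, be produced from initial grid data $\{f_{i,j}^0\}$ by the first order semi-Lagrangian implicit Euler scheme with linear interpolation and discrete Maxwellian $$f_{i,j}^{n+1}=\frac{\kappa\,\tilde f_{ij}^{\,n}+\Delta t\, d\mathcal{M}(\tilde f_{ij}^{\,n})}{\kappa+\Delta t},\qquad 1\le i\le N_x,\ 0\le j\le N_v,\ 0\le n\le N_t-1,$$ with periodic boundary conditions in $x$, where $d\mathcal{M}(\tilde f_{ij}^{\,n})$ is a discrete Maxwellian matching the discrete moments of $\tilde f^{\,n}_{ij}$ within tolerance $tol$. Then $$\max_{1\le \ell\le 3}\left|\sum_{i=1}^{N_x}\sum_{j=0}^{N_v}\left(f_{i,j}^{N_t}-f_{i,j}^{0}\right)\phi_\ell(v_j)\,\Delta v\,\Delta x\right|\le \frac{N_t\,\Delta t}{\kappa+\Delta t}\,(x_{max}-x_{min})\,tol .$$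
   Context: The scheme approximates the one-dimensional BGK equation $\partial_t f+v\,\partial_x f=\frac1\kappa(\mathcal M(f)-f)$ with Knudsen number $\kappa>0$, where $\mathcal M(f)$ is the local Maxwellian of $f$. Grid: $\Delta x=(x_{max}-x_{min})/N_x$, $x_i=x_{min}+(i-\frac12)\Delta x$ for $i=1,\dots,N_x$; $\Delta v=(v_{max}-v_{min})/N_v$, $v_j=v_{min}+j\Delta v$ for $j=0,\dots,N_v$; $\Delta t>0$, $t^n=n\Delta t$ for $n=0,\dots,N_t$. The quantity $f^n_{i,j}$ approximates $f(x_i,v_j,t^n)$ and is extended $N_x$-periodically in $i$ (the definition of $x_i$ is extended to all integers $i$). Collision invariants: $\phi(v)=(\phi_1(v),\phi_2(v),\phi_3(v))^T=(1,v,\tfrac{v^2}{2})^T$. Interpolation: $\tilde f^{\,n}_{ij}$ is the value at the foot of the characteristic $x_i-v_j\Delta t$ of the piecewise linear interpolant in $x$ of the grid data $\{f^n_{i,j}\}_i$ ($j$ fixed). Explicitly, with $i^*=\lfloor i-v_j\Delta t/\Delta x\rfloor$, $\tilde f^{\,n}_{ij}=\theta_j f^n_{i^*+1,j}+(1-\theta_j)f^n_{i^*,j}$, where $\theta_j=(x_i-v_j\Delta t-x_{i^*})/\Delta x\in[0,1)$, which does not depend on $i$. Discrete Maxwellian: for each $n$ and $i$, $d\mathcal M(\tilde f^{\,n}_{ij})=\exp(a_i^n\cdot\phi(v_j))$ with a vector $a_i^n\in\mathbb R^3$ (independent of $j$), computed (e.g. by a Newton algorithm, assumed successful) so that $$\max_{1\le\ell\le3}\left|\sum_{j=0}^{N_v}\left(d\mathcal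 M(\tilde f_{ij}^{\,n})-\tilde f_{ij}^{\,n}\right)\phi_\ell(v_j)\,\Delta v\right|<tol,$$ where $tol>0$ is a given tolerance. *)

(* Defs.v *)
From HB Require Import structures.
From mathcomp Require Import all_boot all_order all_algebra.
From mathcomp Require Import all_classical all_reals all_analysis.
Set Implicit Arguments.
Unset Strict Implicit.
Unset Printing Implicit Defensive.
Import Order.TTheory GRing.Theory Num.Theory.
Local Open Scope ring_scope.

Record grid (R : realType) := Grid {
  xmin : R; xmax : R; Nx : nat;
  vmin : R; vmax : R; Nv : nat;
  dt : R }.

Definition dx (R : realType) (g : grid R) : R := (xmax g - xmin g) / (Nx g)%:R.

Definition dv (R : realType) (g : grid R) : R := (vmax g - vmin g) / (Nv g)%:R.

(* x_i, for every integer i; the cells are numbered from i = 1 to i = Nx *)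
Definition xgrid (R : realType) (g : grid R) (i : int) : R :=
  xmin g + (i%:~R - 2^-1) * dx g.

Definition vgrid (R : realType) (g : grid R) (j : 'I_(Nv g).+1) : R :=
  vmin g + j%:R * dv g.

Definition phi (R : realType) (v : R) : 'rV[R]_3 :=
  \row_(l < 3) [:: 1; v; v ^+ 2 / 2]`_l.

(* i^*, the index of the grid point at, or next to the left of, the foot
   x_i - v_j dt *)
Definition foot (R : realType) (g : grid R) (i : int) (j : 'I_(Nv g).+1) : int :=
  Num.floor (i%:~R - vgrid j * dt g / dx g).

(* theta_j; written with i, although its value does not depend on i *)
Definition theta (R : realType) (g : grid R) (i : int) (j : 'I_(Nv g).+1) : R :=
  (xgrid g i - vgrid j * dt g - xgrid g (foot i j)) / dx g.

(* piecewise linear interpolation in x, at x_i - v_j dt, of the data u given on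
   all integers (by periodic extension) *)
Definition interp (R : realType) (g : grid R) (u : int -> 'I_(Nv g).+1 -> R)
    (i : int) (j : 'I_(Nv g).+1) : R :=
  theta i j * u (foot i j + 1) j + (1 - theta i j) * u (foot i j) j.

Definition x_periodic (R : realType) (g : grid R)
    (u : int -> 'I_(Nv g).+1 -> R) : Prop :=
  forall i j, u (i + (Nx g)%:Z) j = u i j.

(* M is a discrete Maxwellian for the velocity profile w (at one point in
   space): an exponential of a combination of the collision invariants whose
   discrete moments match those of w up to tol.  The maximum may start from 0
   since it is taken over absolute values. *)
Definition discrete_Maxwellian (R : realType) (g : grid R) (tol : R)
    (w M : 'I_(Nv g).+1 -> R) : Prop :=
  (exists a : 'rV[R]_3, forall j : 'I_(Nv g).+1,
     M j = expR (\sum_(l < 3) a 0 l * phi (vgrid j) 0 l)) /\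
  \big[Num.max/0]_(l < 3)
    `| \sum_(j < (Nv g).+1) (M j - w j) * phi (vgrid j) 0 l * dv g | < tol.

(* Main.v *)
Require Import Defs.
From HB Require Import structures.
From mathcomp Require Import all_boot all_order all_algebra.
From mathcomp Require Import all_classical all_reals all_analysis.
From mathcomp Require Import ring.
Import Order.TTheory GRing.Theory Num.Theory.
Local Open Scope ring_scope.

(** Writing one step of the scheme as
      [f^{n+1} = tilde f^n + dt / (kappa + dt) * (dM - tilde f^n)]
    splits the evolution into transport and relaxation.  Transport conserves
    every discrete velocity moment exactly: for fixed [j] the foot of the
    characteristic lies at the same offset from [x_i] for all [i], so the
    interpolant is a fixed combination, with weights [theta] and [1 - theta],
    of two translates of a periodic sequence, and summing over a period does
    not see translations ([sum_interp]).  Relaxation changes the moment in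
    each cell by less than [dt / (kappa + dt) * tol], hence the total moment
    by at most [dt / (kappa + dt) * (xmax - xmin) * tol], since the cells have
    total length [Nx * dx = xmax - xmin] ([total_moment_step]).  The [Nt]
    steps add up by telescoping. *)

(** The difference of the two sides telescopes to [h (N + 1) - h 1]. *)
Lemma sum_periodic_succ (V : zmodType) (N : nat) (h : int -> V) :
  (forall i, h (i + N%:Z) = h i) ->
  \sum_(1 <= i < N.+1) h (i%:Z + 1) = \sum_(1 <= i < N.+1) h i%:Z.
Proof.
move=> hN; apply/eqP; rewrite -subr_eq0 -sumrB.
under eq_bigr => i _ do rewrite -PoszD addn1.
by rewrite (telescope_sumr (fun k => h k%:Z)) // -add1n PoszD hN subrr.
Qed.

Lemma sum_periodic_shift (V : zmodType) (N : nat) (h : int -> V) (s : int) :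
  (forall i, h (i + N%:Z) = h i) ->
  \sum_(1 <= i < N.+1) h (i%:Z + s) = \sum_(1 <= i < N.+1) h i%:Z.
Proof.
move=> hN; have hsN t i : h (i + N%:Z + t) = h (i + t) by rewrite addrAC hN.
elim: s => [|n IHn|n IHn]; first by under eq_bigr => i _ do rewrite addr0.
  rewrite -IHn -[RHS](sum_periodic_succ _ _ (fun i => h (i + n%:Z))) //.
  by apply: eq_bigr => i _; rewrite -addrA -add1n PoszD.
rewrite -IHn -[LHS](sum_periodic_succ _ _ (fun i => h (i - n.+1%:Z))) //.
by apply: eq_bigr => i _; rewrite -addrA -add1n PoszD opprD addNKr.
Qed.

Section Transport.
Variables (R : realType) (g : grid R).
Implicit Type u : int -> 'I_(Nv g).+1 -> R.
Hypotheses (hx : xmin g < xmax g) (hNx : (0 < Nx g)%N).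

Lemma dx_gt0 : 0 < dx g.
Proof. by rewrite divr_gt0 ?subr_gt0 ?ltr0n. Qed.

Lemma Nx_dx : (Nx g)%:R * dx g = xmax g - xmin g.
Proof. by rewrite mulrC divfK // pnatr_eq0 -lt0n. Qed.

(** The floor commutes with integer translations, so the cell containing the
    foot moves along with [x_i]. *)
Lemma foot_translate (i : int) (j : 'I_(Nv g).+1) : foot i j = i + foot 0 j.
Proof. by rewrite /foot floorDzr ?intr_int // intrKfloor add0r. Qed.

Lemma theta_translate (i : int) (j : 'I_(Nv g).+1) : theta i j = theta 0 j.
Proof.
rewrite /theta foot_translate /xgrid; congr (_ / _).
by rewrite intrD; ring.
Qed.

Lemma sum_interp u (j : 'I_(Nv g).+1) : x_periodic u ->
  \sum_(1 <= i < (Nx g).+1) interp u i%:Z j =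
  \sum_(1 <= i < (Nx g).+1) u i%:Z j.
Proof.
move=> hu.
under eq_bigr => i _ do rewrite /interp theta_translate foot_translate -addrA.
rewrite big_split /= -!mulr_sumr.
by rewrite !(sum_periodic_shift _ _ (fun i => u i j)) // -mulrDl subrKC mul1r.
Qed.

Definition total_moment (l : 'I_3) u : R :=
  \sum_(1 <= i < (Nx g).+1) \sum_(j < (Nv g).+1)
    u i%:Z j * phi (vgrid j) 0 l * dv g * dx g.

Lemma total_momentB (l : 'I_3) u w :
  total_moment l (fun i j => u i j - w i j) =
  total_moment l u - total_moment l w.
Proof.
rewrite /total_moment -sumrB; apply: eq_bigr => i _.
by rewrite -sumrB; apply: eq_bigr => j _; ring.
Qed.

(** Conservation by transport holds for each velocity [v_j] separately, so the
    sum over space is taken first. *)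
Lemma total_moment_interp (l : 'I_3) u : x_periodic u ->
  total_moment l (interp u) = total_moment l u.
Proof.
move=> hu; rewrite /total_moment exchange_big [RHS]exchange_big /=.
by apply: eq_bigr => j _; rewrite -!mulr_suml sum_interp.
Qed.

Lemma total_moment_step (l : 'I_3) (kappa tol : R) u u' M :
  0 < dt g -> 0 < kappa -> x_periodic u ->
  (forall i : int, 1 <= i <= (Nx g)%:Z ->
     discrete_Maxwellian tol (interp u i) (M i)) ->
  (forall (i : int) j, 1 <= i <= (Nx g)%:Z ->
     u' i j = (kappa * interp u i j + dt g * M i j) / (kappa + dt g)) ->
  `|total_moment l u' - total_moment l u| <=
    dt g / (kappa + dt g) * (xmax g - xmin g) * tol.
Proof.
move=> hdt hk hu hM hu'.
have hkdt : 0 < kappa + dt g by rewrite addr_gt0.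
(* the interpolant has the moments of u and differs from u' only by relaxation *)
rewrite -(total_moment_interp l u) // -total_momentB.
have -> : total_moment l (fun i j => u' i j - interp u i j) =
    dt g / (kappa + dt g) * dx g *
    \sum_(1 <= i < (Nx g).+1) \sum_(j < (Nv g).+1)
      (M i%:Z j - interp u i%:Z j) * phi (vgrid j) 0 l * dv g.
  rewrite /total_moment mulr_sumr !big_nat; apply: eq_bigr => i /andP[i1 iN].
  rewrite mulr_sumr; apply: eq_bigr => j _.
  by rewrite hu' ?lez_nat ?i1 //; field; rewrite gt_eqF.
have c0 : 0 <= dt g / (kappa + dt g) * dx g.
  by apply: mulr_ge0; [apply: divr_ge0 |]; apply: ltW => //; exact: dx_gt0.
rewrite normrM ger0_norm // -Nx_dx.
have -> : dt g / (kappa + dt g) * ((Nx g)%:R * dx g) * tol =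
    dt g / (kappa + dt g) * dx g * ((Nx g)%:R * tol) by ring.
apply: ler_wpM2l => //; apply: le_trans (ler_norm_sum _ _ _) _.
have -> : (Nx g)%:R * tol = \sum_(1 <= i < (Nx g).+1) tol.
  by rewrite sumr_const_nat subn1 mulr_natl.
apply: ler_sum_nat => i /andP[i1 iN].
have [|_ /ltW] := hM i%:Z; first by rewrite !lez_nat i1.
by move=> /bigmax_leP[_ /(_ l)]; apply.
Qed.

End Transport.

Theorem mainTheorem1 (R : realType) (g : grid R) (kappa tol : R) (Nt : nat)
  (f dM : nat -> int -> 'I_(Nv g).+1 -> R)
  (hx : xmin g < xmax g) (hNx : (0 < Nx g)%N)
  (hv : vmin g < vmax g) (hNv : (0 < Nv g)%N)
  (hdt : 0 < dt g) (hkappa : 0 < kappa) (htol : 0 < tol)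
  (hper : forall n : nat, (n <= Nt)%N -> x_periodic (f n))
  (hdM : forall (n : nat) (i : int), (n < Nt)%N -> 1 <= i <= (Nx g)%:Z ->
     discrete_Maxwellian tol (interp (f n) i) (dM n i))
  (hscheme : forall (n : nat) (i : int) (j : 'I_(Nv g).+1),
     (n < Nt)%N -> 1 <= i <= (Nx g)%:Z ->
     f n.+1 i j =
       (kappa * interp (f n) i j + dt g * dM n i j) / (kappa + dt g)) :
  \big[Num.max/0]_(l < 3)
    `| \sum_(1 <= i < (Nx g).+1) \sum_(j < (Nv g).+1)
         (f Nt i%:Z j - f 0%N i%:Z j) * phi (vgrid j) 0 l * dv g * dx g |
  <= Nt%:R * dt g / (kappa + dt g) * (xmax g - xmin g) * tol.
Proof.
apply/bigmax_leP; split=> [|l _].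
  by rewrite !mulr_ge0 ?ler0n ?subr_ge0 ?invr_ge0 ?addr_ge0 ?ltW.
rewrite -/(total_moment _ g l (fun i j => f Nt i j - f 0%N i j)) total_momentB.
rewrite -(telescope_sumr (fun n => total_moment _ g l (f n))) //.
apply: le_trans (ler_norm_sum _ _ _) _.
have -> : Nt%:R * dt g / (kappa + dt g) * (xmax g - xmin g) * tol =
    \sum_(0 <= n < Nt) (dt g / (kappa + dt g) * (xmax g - xmin g) * tol).
  by rewrite sumr_const_nat subn0 -[RHS]mulr_natl !mulrA.
apply: ler_sum_nat => n /= nNt.
apply: (@total_moment_step _ _ hx hNx l kappa tol (f n) (f n.+1) (dM n)) => //.
- by apply: hper; exact: ltnW.
- by move=> i; exact: hdM.
- by move=> i j; exact: hscheme.
Qed.
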